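(* Let $(S,\Sigma)$ be a measurable space and let $\mathrm{M}$ be the set of all nonnegative real-valued (hence finite) measures on $\Sigma$. Let $k\ge 1$ be an integer, let $f_1,\dots,f_k\colon S\to\mathbb{R}$ be $\Sigma$-measurable functions, $\mathbf{f}=(f_1,\dots,f_k)$, and let $C\subseteq\mathbb{R}^k$ be any set. Let $\Lambda\subseteq\mathrm{M}$ be a convex cone such that $\mu_A\in\Lambda$ for all $\mu\in\Lambda$ and all $A\in\Sigma$. Let $\Lambda_{\mathbf{f},C}=\{\mu\in\Lambda\colon \mathbf{f}\in L^1(\mu),\ \int_S\mathbf{f}\,d\mu\in C\}$. Take any $\mu\in\operatorname{ex}\Lambda_{\mathbf{f},C}$ with $\mu\neq 0$. Then for some integer $m$ with $1\le m\le k$ there is an atomic non-null $(m,\mu)$-partition $(A_1,\dots,A_m)$ of $S$ such that the vectors $\int_{A_1}\mathbf{f}\,d\mu,\dots,\int_{A_m}\mathbf{f}\,d\mu$ in $\mathbb{R}^k$ are linearly independent.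
   Context: For $\mu\in\mathrm{M}$ and $A\in\Sigma$, the truncation $\mu_A\in\mathrm{M}$ is defined by $\mu_A(B)=\mu(A\cap B)$ for $B\in\Sigma$. A set $A\in\Sigma$ is a $\mu$-atom if $\mu_A(B)\in\{0,\mu(A)\}$ for all $B\in\Sigma$ (so $\mu$-null sets are allowed as $\mu$-atoms). An $n$-tuple $(A_1,\dots,A_n)$ of members of $\Sigma$ is a non-null $(n,\mu)$-partition of $S$ if the $A_i$ are pairwise disjoint, $A_1\cup\dots\cup A_n=S$, and $\mu(A_i)>0$ for all $i$; it is atomic if each $A_i$ is a $\mu$-atom. One writes $\mathbf{f}\in L^1(\mu)$ if every $f_j$ is $\mu$-integrable, and $\int_A\mathbf{f}\,d\mu=(\int_A f_1\,d\mu,\dots,\int_A f_k\,d\mu)$. For a (not necessarily convex) set $\mathrm{K}\subseteq\mathrm{M}$, $\operatorname{ex}\mathrm{K}$ is the set of all extreme points of $\mathrm{K}$: $\mu\in\operatorname{ex}\mathrm{K}$ iff $\mu\in\mathrm{K}$ and for any $t\in(0,1)$ and $\nu_0,\nu_1\in\mathrm{K}$ with $(1-t)\nu_0+t\nu_1=\mu$ one has $\nu_0=\nu_1$. *)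

(* Defs.v *)
From HB Require Import structures.
From mathcomp Require Import all_boot all_order all_algebra.
From mathcomp Require Import all_classical all_reals all_analysis.

Set Implicit Arguments.
Unset Strict Implicit.
Unset Printing Implicit Defensive.

Import Order.TTheory GRing.Theory Num.Theory.
Import numFieldNormedType.Exports.

Local Open Scope classical_set_scope.
Local Open Scope ring_scope.

Section finite_measure_add.
Context d (S : measurableType d) (R : realType).
Variables mu nu : {finite_measure set S -> \bar R}.

Let fin_num_measure_add : fin_num_fun (measure_add mu nu).
Proof.
by move=> A mA; rewrite measure_addE fin_numD !fin_num_measure.
Qed.

HB.instance Definition _ := Measure.copy (measure_add mu nu)
  (msum (fun n => if n is 0%N then mu : {measure set S -> \bar R} else nu) 2).

HB.instance Definition _ :=
  Measure_isFinite.Build _ S R (measure_add mu nu) fin_num_measure_add.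

End finite_measure_add.

Section sets_of_measures.
Context d (S : measurableType d) (R : realType).
Local Notation M := {finite_measure set S -> \bar R}.
Implicit Types (mu nu : M) (K L : set M) (A B : set S).

(* A term of type M also has (irrelevant) values on non-measurable sets, so
   equality of measures is agreement on the sigma-algebra, and a set of measures
   is a subset of M that is invariant under that agreement. *)
Definition measure_eq mu nu := forall B, measurable B -> mu B = nu B.

Definition measure_set L :=
  forall mu nu, measure_eq mu nu -> L mu -> L nu.

(* Whether 0 is required to belong to a convex cone makes no difference here:
   a nonempty truncation-closed set contains the truncation to set0. *)
Definition convex_cone L :=
  (forall mu nu, L mu -> L nu -> L (measure_add mu nu)) /\
  (forall (r : {nonneg R}) mu, 0 < r%:num -> L mu -> L (mscale r mu)).

Definition truncation_closed L :=
  forall mu, L mu -> forall A (mA : measurable A), L (mrestr mu mA).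

Definition extreme_points K : set M :=
  [set mu | K mu /\
    forall (t : R) nu0 nu1, 0 < t < 1 -> K nu0 -> K nu1 ->
      (forall B, measurable B ->
         ((1 - t)%:E * nu0 B + t%:E * nu1 B)%E = mu B) ->
      measure_eq nu0 nu1].

Definition atom mu A :=
  measurable A /\
  forall B, measurable B -> mu (A `&` B) = 0%E \/ mu (A `&` B) = mu A.

Definition nonnull_partition mu (n : nat) (A : 'I_n -> set S) :=
  [/\ forall i, measurable (A i),
      trivIset [set: 'I_n] A,
      \bigcup_i A i = [set: S] &
      forall i, (0 < mu (A i))%E].

Definition atomic_nonnull_partition mu (n : nat) (A : 'I_n -> set S) :=
  nonnull_partition mu A /\ forall i, atom mu (A i).

Definition L1 (k : nat) (f : 'I_k -> S -> R) mu :=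
  forall j, mu.-integrable [set: S] (EFin \o f j).

Definition vec_integral (k : nat) (f : 'I_k -> S -> R) mu A : 'rV[R]_k :=
  \row_(j < k) (\int[mu]_(x in A) f j x).

Definition moment_set L (k : nat) (f : 'I_k -> S -> R) (C : set 'rV[R]_k)
    : set M :=
  [set mu | [/\ L mu, L1 f mu & C (vec_integral f mu [set: S])]].

End sets_of_measures.

(* Main.v *)
Require Import Defs.
From HB Require Import structures.
From mathcomp Require Import all_boot all_order all_algebra.
From mathcomp Require Import all_classical all_reals all_analysis.
From mathcomp Require Import measurable_realfun lra.

Set Implicit Arguments.
Unset Strict Implicit.
Unset Printing Implicit Defensive.

Import Order.TTheory GRing.Theory Num.Theory.
Import numFieldNormedType.Exports.

Local Open Scope classical_set_scope.
Local Open Scope ring_scope.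

(** Given a non-null partition A_1, ..., A_n and a linear relation
    sum_i u_i int_(A_i) f = 0, for small e > 0 the measures
    sum_i (1 +- e u_i) mu_(A_i) lie in the cone, have the same f-moments as mu,
    and have mu as midpoint; extremality makes them equal, so u = 0. Hence every
    non-null partition has at most k members, and one with the largest number of
    members is atomic, since a set that is not an atom splits into two non-null
    pieces. *)

Section extreme_measures.
Context d (S : measurableType d) (R : realType).
Local Notation M := {finite_measure set S -> \bar R}.
Implicit Types (mu nu : M) (A B D : set S).

(** The complement of [D] is null for the truncation, and on measurable subsets of [D] the
    truncation agrees with [mu]. *)
Lemma integral_mrestr mu D (mD : measurable D) (g : S -> \bar R) :
  measurable_fun [set: S] g ->
  (\int[mrestr mu mD]_x g x = \int[mu]_(x in D) g x)%E.
Proof.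
move=> mg; have mDc := measurableC mD.
rewrite -(setUv D) integral_setU//; last 2 first.
- exact: measurable_funS mg.
- exact/disj_setPCl.
rewrite [X in (_ + X)%E]null_set_integral ?adde0//; last 2 first.
- exact: measurable_funS mg.
- by rewrite /= /mrestr setICl measure0.
apply: eq_measure_integral => A mA AD.
by rewrite /= /mrestr setIidl.
Qed.

(** Scaling commutes with the integrals of the positive and negative parts; integrability makes the
    latter finite, so the factor distributes over their difference. *)
Lemma integral_mscale (r : {nonneg R}) (mu : {measure set S -> \bar R})
    (g : S -> \bar R) :
  mu.-integrable [set: S] g ->
  (\int[mscale r mu]_x g x = r%:num%:E * \int[mu]_x g x)%E.
Proof.
move=> /[dup] ig /integrableP[mg _].
rewrite [LHS]integralE [X in (_ * X)%E]integralE.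
rewrite ge0_integral_mscale//; last exact: measurable_funepos.
rewrite ge0_integral_mscale//; last exact: measurable_funeneg.
rewrite -(@muleBr R _ (\int[mu]_x g^\+ x)%E (\int[mu]_x g^\- x)%E)// fin_num_adde_defl//.
by rewrite fin_numN integrable_neg_fin_num.
Qed.

Lemma integrable_mscale_mrestr (r : {nonneg R}) mu D (mD : measurable D)
    (g : S -> \bar R) :
  mu.-integrable [set: S] g ->
  (mscale r (mrestr mu mD)).-integrable [set: S] g /\
  (\int[mscale r (mrestr mu mD)]_x g x =
    r%:num%:E * \int[mu]_(x in D) g x)%E.
Proof.
move=> ig; have /integrableP[mg goo] := ig.
have mag : measurable_fun [set: S] (fun x => `|g x|)%E.
  exact: measurableT_comp.
have igD : (mrestr mu mD).-integrable [set: S] g.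
  apply/integrableP; split => //; rewrite integral_mrestr//.
  apply: le_lt_trans goo; exact: ge0_subset_integral.
split; last by rewrite integral_mscale// integral_mrestr.
apply/integrableP; split => //; rewrite ge0_integral_mscale//.
by rewrite lte_mul_pinfty//; have /integrableP[] := igD.
Qed.

Lemma integrable_measure_add mu nu (g : S -> \bar R) :
  mu.-integrable [set: S] g -> nu.-integrable [set: S] g ->
  (measure_add mu nu).-integrable [set: S] g.
Proof.
move=> /integrableP[mg goo] /integrableP[_ goo'].
have mag : measurable_fun [set: S] (fun x => `|g x|)%E.
  exact: measurableT_comp.
apply/integrableP; split => //.
by rewrite ge0_integral_measure_add// lte_add_pinfty.
Qed.

(** The witness is the sum of the [r i] multiples of the truncations of [mu] to [A i], built by
    induction inside the cone. It is described through integrals only: [g = f j] yields its moments,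
    and an indicator yields its value on a set. *)
Lemma weighted_truncations (Lambda : set M) mu (n : nat)
    (A : 'I_n.+1 -> set S) (r : 'I_n.+1 -> R) :
  convex_cone Lambda -> truncation_closed Lambda -> Lambda mu ->
  (forall i, measurable (A i)) -> (forall i, 0 < r i) ->
  exists nu, Lambda nu /\
    forall g : S -> R, mu.-integrable [set: S] (EFin \o g) ->
      nu.-integrable [set: S] (EFin \o g) /\
      \int[nu]_x g x = \sum_i r i * \int[mu]_(x in A i) g x.
Proof.
move=> [LD LZ] LT Lmu.
have one D (mD : measurable D) (s : R) : 0 < s -> exists nu, Lambda nu /\
    forall g : S -> R, mu.-integrable [set: S] (EFin \o g) ->
      nu.-integrable [set: S] (EFin \o g) /\
      \int[nu]_x g x = s * \int[mu]_(x in D) g x.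
  move=> s0; exists (mscale (NngNum (ltW s0)) (mrestr mu mD)); split.
    by apply: LZ => //; exact: LT.
  move=> g ig; have [ig' gE] := integrable_mscale_mrestr (NngNum (ltW s0)) mD ig.
  split=> //; rewrite /Rintegral gE fineM//.
  by apply: integrable_fin_num => //; exact: integrableS ig.
elim: n A r => [|n IHn] A r mA r0.
  have [nu [Lnu nuE]] := one _ (mA ord0) _ (r0 ord0).
  exists nu; split=> // g ig; have [? ->] := nuE g ig.
  by rewrite big_ord1.
have [nu0 [Lnu0 nu0E]] := one _ (mA ord0) _ (r0 ord0).
have [nu1 [Lnu1 nu1E]] := IHn _ _ (fun i => mA (lift ord0 i))
  (fun i => r0 (lift ord0 i)).
exists (measure_add nu0 nu1); split; first exact: LD.
move=> g ig; have [ig0 gE0] := nu0E g ig; have [ig1 gE1] := nu1E g ig.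
split; first exact: integrable_measure_add.
rewrite big_ord_recl -gE0 -gE1 /Rintegral integral_measure_add//.
by rewrite fineD//; exact: integrable_fin_num.
Qed.

Lemma Rintegral_partition mu (n : nat) (A : 'I_n -> set S) (g : S -> R) :
  nonnull_partition mu A -> mu.-integrable [set: S] (EFin \o g) ->
  \int[mu]_x g x = \sum_i \int[mu]_(x in A i) g x.
Proof.
move=> [mA tA UA _] ig.
have UE : \big[setU/set0]_(i <- index_enum 'I_n) A i = [set: S].
  rewrite -UA -bigcup_seq; apply: eq_bigcupl.
  by split=> i //= _; rewrite mem_index_enum.
rewrite /Rintegral -[X in integral _ X]UE integral_bigsetU_EFin//.
- rewrite sum_fine// => i _; apply: integrable_fin_num => //.
  exact: integrableS ig.
- exact: index_enum_uniq.
- exact: sub_trivIset tA.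
- by rewrite UE; exact: measurable_int ig.
Qed.

Lemma Rintegral_indic mu A B : measurable A -> measurable B ->
  \int[mu]_(x in A) \1_B x = fine (mu (B `&` A)).
Proof. by move=> mA mB; rewrite /Rintegral integral_indic. Qed.

Lemma extreme_point_row_free (k : nat) (f : 'I_k -> S -> R)
    (C : set 'rV[R]_k) (Lambda : set M) mu (n : nat) (A : 'I_n -> set S) :
  convex_cone Lambda -> truncation_closed Lambda ->
  extreme_points (moment_set Lambda f C) mu ->
  nonnull_partition mu A ->
  row_free (\matrix_(i < n) vec_integral f mu (A i)).
Proof.
(* The empty family is set apart because [weighted_truncations] sums at least one piece. *)
case: n A => [A _ _ _ _|n A Lcone Ltrunc [[Lmu f1 Cmu] mu_ex] partA].
  by apply: inj_row_free => v _; rewrite [v]thinmx0.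
have [mA tA UA A0] := partA.
apply: inj_row_free => u uM0.
(* [c] exceeds every [|u 0 i|], so all weights [1 + e * u 0 i] and [1 - e * u 0 i] are positive. *)
pose c := 1 + \sum_i `|u 0 i|; pose e := c^-1.
have c0 : 0 < c by rewrite ltr_wpDr// sumr_ge0.
have e0 : 0 < e by rewrite invr_gt0.
have eu i : `|e * u 0 i| < 1.
  rewrite normrM gtr0_norm// mulrC ltr_pdivrMr// mul1r /c (bigD1 i)//=.
  by rewrite addrCA ltrDl ltr_wpDr// sumr_ge0.
have r_gt0 (s : R) : `|s| = 1 -> forall i, 0 < 1 + s * (e * u 0 i).
  move=> s1 i; have := eu i.
  rewrite -[X in X < 1]mul1r -s1 -normrM ltr_norml => /andP[+ _].
  by rewrite -subr_gt0 opprK addrC.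
(* The condition [|s| = 1] treats the two perturbations [s = 1] and [s = -1] at once. *)
have perturb (s : R) : `|s| = 1 -> exists nu, moment_set Lambda f C nu /\
    forall B, measurable B ->
      nu B = (\sum_i (1 + s * (e * u 0 i)) * fine (mu (B `&` A i)))%:E.
  move=> s1.
  have [nu [Lnu nuE]] :=
    weighted_truncations Lcone Ltrunc Lmu mA (r_gt0 s s1).
  exists nu; split; last first.
    move=> B mB; have [_] := nuE _ (integrable_indic mu mB).
    rewrite Rintegral_indic// setIT => nuB.
    rewrite -[LHS]fineK ?fin_num_measure// nuB; congr EFin.
    by apply: eq_bigr => i _; rewrite Rintegral_indic.
  split=> // [j|]; first by have [] := nuE _ (f1 j).
  rewrite (_ : vec_integral f nu _ = vec_integral f mu [set: S])//.
  apply/rowP => j; have [_] := nuE _ (f1 j); rewrite !mxE => ->.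
  rewrite (Rintegral_partition partA (f1 j)).
  (* The change of the [j]-th moment is [s * e] times an entry of the vanishing combination [u] of
     the rows. *)
  transitivity (\sum_i \int[mu]_(x in A i) f j x +
     s * e * (u *m \matrix_(i < n.+1) vec_integral f mu (A i)) 0 j).
    rewrite mxE mulr_sumr -big_split/=; apply: eq_bigr => i _.
    by rewrite !mxE mulrDl mul1r !mulrA.
  by rewrite uM0 mxE mulr0 addr0.
have [nu0 [K0 nu0E]] := perturb (-1) (normrN1 _).
have [nu1 [K1 nu1E]] := perturb 1 (normr1 _).
have half : (0 < 2^-1 :> R) && (2^-1 < 1 :> R) by apply/andP; split; lra.
have mid B : measurable B ->
    ((1 - 2^-1)%:E * nu0 B + (2^-1)%:E * nu1 B)%E = mu B.
  move=> mB; rewrite nu0E// nu1E// -!EFinM -EFinD.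
  rewrite -[RHS]fineK ?fin_num_measure//; congr EFin.
  (* [mu B] splits along the partition, and on each piece the two opposite weights average to 1. *)
  have := Rintegral_partition partA (integrable_indic mu mB).
  rewrite Rintegral_indic// setIT => ->.
  rewrite !mulr_sumr -big_split/=; apply: eq_bigr => i _.
  by rewrite Rintegral_indic//; lra.
have nu01 := mu_ex _ _ _ half K0 K1 mid.
apply/rowP => i; rewrite [RHS]mxE.
have := nu01 _ (mA i); rewrite nu0E// nu1E// => -[].
(* On [B = A i] disjointness leaves only the [i]-th term; cancelling [mu (A i)], which is positive,
   gives [1 - e * u 0 i = 1 + e * u 0 i]. *)
have onlyi (a : 'I_n.+1 -> R) :
    \sum_j a j * fine (mu (A i `&` A j)) = a i * fine (mu (A i)).
  rewrite (bigD1 i)//= setIid big1 ?addr0// => j ji.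
  by move/trivIsetP: tA => -> //; rewrite ?measure0 ?mulr0// eq_sym.
rewrite !onlyi => /mulIf.
have -> : fine (mu (A i)) != 0.
  by rewrite gt_eqF// fine_gt0// A0/= ltey_eq fin_num_measure.
move=> /(_ isT) eui; have /eqP : e * u 0 i = 0 by lra.
by rewrite mulf_eq0 (gt_eqF e0) => /eqP.
Qed.

Lemma maximal_partition_atom mu (n : nat) (A : 'I_n -> set S) :
  nonnull_partition mu A ->
  (forall A' : 'I_n.+1 -> set S, ~ nonnull_partition mu A') ->
  forall i, atom mu (A i).
Proof.
move=> [mA tA UA A0] nomax i; split=> // B mB.
have AE : mu (A i) = (mu (A i `\` B) + mu (A i `&` B))%E.
  exact: measureDI.
have [->|I0] := eqVneq (mu (A i `&` B)) 0%E; first by left.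
have [D0|D0] := eqVneq (mu (A i `\` B)) 0%E.
  by right; rewrite AE D0 add0e.
(* Index 0 receives [A i] minus [B]; the old indices are shifted by one, with [A i] replaced by its
   intersection with [B]. *)
exfalso; pose A' (j : 'I_n.+1) := if unlift ord0 j is Some l
  then if l == i then A i `&` B else A l else A i `\` B.
have A'0 : A' ord0 = A i `\` B by rewrite /A' unlift_none.
have A'i : A' (lift ord0 i) = A i `&` B by rewrite /A' liftK eqxx.
have A'l l : l != i -> A' (lift ord0 l) = A l.
  by move=> /negbTE li; rewrite /A' liftK li.
have A'sub l : A' (lift ord0 l) `<=` A l.
  by case: (eqVneq l i) => [->|/A'l ->//]; rewrite A'i => x [].
apply: (nomax A'); split.
- move=> j; case: (unliftP ord0 j) => [l|] ->; last first.
    by rewrite A'0; exact: measurableD.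
  by case: (eqVneq l i) => [->|/A'l ->//]; rewrite A'i; exact: measurableI.
(* Shifted pieces lie inside the old disjoint ones, so the new piece 0 is the only one whose
   disjointness from the others needs an argument. *)
- have dis l x : A' ord0 x -> A' (lift ord0 l) x -> False.
    rewrite A'0 => -[Aix nBx]; have [->|li] := eqVneq l i.
      by rewrite A'i => -[].
    by rewrite A'l// => Alx; move/eqP: li; apply; apply: tA => //; exists x.
  move=> j1 j2 _ _ [x []].
  case: (unliftP ord0 j1) => [l1|] ->; case: (unliftP ord0 j2) => [l2|] -> //.
  + by move=> /A'sub x1 /A'sub x2; congr lift; apply: tA => //; exists x.
  + by move=> h1 h2; case: (dis _ _ h2 h1).
  + by move=> h1 h2; case: (dis _ _ h1 h2).
- apply/seteqP; split=> // x _.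
  have [l _ Alx] : (\bigcup_i A i) x by rewrite UA.
  have [li|li] := eqVneq l i; last by exists (lift ord0 l); rewrite ?A'l.
  rewrite li in Alx; have [Bx|nBx] := pselect (B x).
    by exists (lift ord0 i); rewrite ?A'i.
  by exists ord0; rewrite ?A'0.
- move=> j; case: (unliftP ord0 j) => [l|] ->.
    case: (eqVneq l i) => [->|/A'l ->//].
    by rewrite A'i lt0e I0 measure_ge0.
  by rewrite A'0 lt0e D0 measure_ge0.
Qed.

End extreme_measures.

Theorem theorem1 (R : realType) (d : measure_display) (S : measurableType d)
    (k : nat) (k_ge1 : (1 <= k)%N)
    (f : 'I_k -> S -> R) (mf : forall j, measurable_fun [set: S] (f j))
    (C : set 'rV[R]_k)
    (Lambda : set {finite_measure set S -> \bar R})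
    (Lambda_set : measure_set Lambda)
    (Lambda_cone : convex_cone Lambda)
    (Lambda_trunc : truncation_closed Lambda)
    (mu : {finite_measure set S -> \bar R})
    (mu_ex : extreme_points (moment_set Lambda f C) mu)
    (mu_neq0 : ~ (forall B, measurable B -> mu B = 0%E)) :
  exists m : nat, (1 <= m <= k)%N /\
    exists A : 'I_m -> set S,
      atomic_nonnull_partition mu A /\
      row_free (\matrix_(i < m) vec_integral f mu (A i)).
Proof.
pose P n := `[< exists A : 'I_n -> set S, nonnull_partition mu A >].
have P_le n : P n -> (n <= k)%N.
  move=> /asboolP[A partA].
  (* [n] independent rows of length [k] force [n <= k]. *)
  have := extreme_point_row_free Lambda_cone Lambda_trunc mu_ex partA.
  by rewrite /row_free => /eqP <-; exact: rank_leq_col.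
have muT : mu [set: S] != 0%E.
  apply/eqP => muT0; apply: mu_neq0 => B mB; apply/eqP.
  by rewrite eq_le measure_ge0 andbT -muT0 le_measure ?inE.
(* The partition with the single piece [S] starts the search for a maximum and gives [1 <= m]. *)
have P1 : P 1%N.
  apply/asboolP; exists (fun=> [set: S]); split=> //.
  - by move=> i j _ _ _; rewrite !ord1.
  - by apply/seteqP; split=> // x _; exists ord0.
  - by move=> _; rewrite lt0e muT measure_ge0.
case: (ex_maxnP (ex_intro P _ P1) P_le) => m Pm m_max.
exists m; split; first by rewrite m_max// P_le.
move/asboolP : Pm => [A partA]; exists A; split; last first.
  exact: extreme_point_row_free Lambda_cone Lambda_trunc mu_ex partA.
split=> //; apply: maximal_partition_atom => // A' partA'.
by have := m_max m.+1; rewrite ltnn => /(_ (asboolT (ex_intro _ A' partA'))).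
Qed.
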